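(* Let $N\ge3$ and let $(G,S)$ be a Cayley graph satisfying $\beta_S(n)\ge C(S)n^N$ for all $n\ge1$, for some constant $C(S)>0$. Then $D_0^{1,2}(G)=D^{1,2}(G)$.
   Context: $G$ is a finitely generated group and $S$ a finite generating set with $S=S^{-1}$. The Cayley graph $(G,S)$ has vertex set $G$, and $x\sim y$ iff $x=ys$ for some $s\in S$. $\beta_S(n)$ is the number of elements of $G$ at word distance at most $n$ from the unit element. For $u:G\to\mathbb R$, $\lVert u\rVert_{D^{1,2}(G)}:=\left(\sum_{x\in G}\sum_{y\sim x}|u(y)-u(x)|^2\right)^{1/2}$. $D_0^{1,2}(G)$ is the completion of the finitely supported functions in this norm, its elements being regarded as functions on $G$ (a Cauchy sequence of finitely supported functions is identified with its pointwise limit), and $D^{1,2}(G):=\{u\in\ell^{\frac{2N}{N-2}}(G):\lVert u\rVert_{D^{1,2}(G)}<\infty\}$. *)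

(* Defs.v *)
From HB Require Import structures.
From mathcomp Require Import all_boot all_order all_algebra finmap.
From mathcomp Require Import all_classical all_reals all_analysis.
Set Implicit Arguments.
Unset Strict Implicit.
Unset Printing Implicit Defensive.
Import Order.TTheory GRing.Theory Num.Theory.
Import numFieldNormedType.Exports.

Local Open Scope classical_set_scope.
Local Open Scope ring_scope.

Section CayleyGraph.
Variable G : groupType.
Implicit Types (S : set G) (x y : G).

Definition generated S : set G :=
  smallest [set H : set G | group_closed (mem H)] S.

Definition adj S x y : Prop := exists2 s, S s & x = (y * s)%g.

(* +oo when y is not reachable from x *)
Definition word_dist (R : realType) S x y : \bar R :=
  ereal_inf [set (size w)%:R%:E | w in
    [set w : seq G | {in w, forall s, S s} /\ y = (x * \prod_(s <- w) s)%g]].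

Definition word_ball (R : realType) S (n : nat) : set G :=
  [set x | (word_dist R S 1%g x <= n%:R%:E)%E].

(* fset_set is the empty set on infinite sets, but balls are finite as soon as
   S is finite *)
Definition growth (R : realType) S (n : nat) : nat :=
  #|` fset_set (word_ball R S n) |.

End CayleyGraph.

Section Spaces.
Variables (R : realType) (G : groupType).
Implicit Types (S : set G) (u : G -> R).

Definition D12norm S u : \bar R :=
  sqrte (\esum_(x in [set: G])
           \esum_(y in [set y | adj S y x]) (`|u y - u x| ^+ 2)%:E)%E.

Definition ell (p : R) : set (G -> R) :=
  [set u | summable [set: G] (fun x => (`|u x| `^ p)%:E)].

Definition finitely_supported u : Prop := finite_set [set x | u x != 0].

Definition D12_cauchy S (v : nat -> G -> R) : Prop :=
  forall e : R, 0 < e -> exists n0 : nat, forall m n : nat,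
    (n0 <= m)%N -> (n0 <= n)%N -> (D12norm S (v m \- v n)%R < e%:E)%E.

(* An element of the completion is represented by a Cauchy sequence, and is
   regarded as the function which is the pointwise limit of that sequence. *)
Definition D12_0 S : set (G -> R) :=
  [set u | exists v : nat -> G -> R,
    [/\ forall n, finitely_supported (v n),
        D12_cauchy S v
      & forall x, v n x @[n --> \oo] --> u x]].

Definition D12 (N : R) S : set (G -> R) :=
  [set u | ell (2 * N / (N - 2)) u /\ (D12norm S u < +oo)%E].

End Spaces.

(* Main.v *)
Require Import Defs.
From mathcomp Require Import all_boot all_order all_algebra finmap.
From mathcomp Require Import all_classical all_reals all_analysis.
From mathcomp Require Import ring lra.
Import Order.TTheory GRing.Theory Num.Theory.
Import numFieldNormedType.Exports.
Local Open Scope classical_set_scope.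
Local Open Scope ring_scope.

(** The inclusion of [D12] in [D12_0] is a truncation argument.  Removing from
    [u] its clip to the values between [- e] and [e] leaves a function carried
    by the set where [|u| > e], which is finite because [u] is p-summable.  The error is
    the clip itself: its gradient is dominated by that of [u] and is at most
    [2 e], so its energy tends to 0 with [e] by dominated convergence
    ([clip_energy_cvg0]).

    The other inclusion rests on the Sobolev inequality for finitely supported
    functions, in the form: a bound on the energy forces a bound on the p-norm,
    [p = 2N/(N-2)] ([lp_bound_of_energy_bound]).  It then passes to pointwise
    limits, since both the energy and the p-norm are suprema of finite sums.

    The Sobolev inequality is obtained directly in [l^2], by slicing a
    nonnegative function at the dyadic levels [t_k = t_0 2^k].  Let [a_k] be
    the number of points where [f > t_k], and [e_k] the energy of the slice of
    [f] between [t_k] and [t_(k+1)].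
    - The slice equals [t_k] above the level [t_(k+1)] and vanishes below
      [t_k].  When a ball of radius [n] has at least [2 a_k] elements, each
      point above [t_(k+1)] is moved below [t_k] by at least half of the ball,
      while translating by a word of length at most [n] costs at most [n^2]
      times the energy ([translation_sqdiff_le]).  Hence
      [a_(k+1) t_k^2 <= 2 n^2 e_k], and the growth hypothesis lets [n] be of
      order [a_k^(1/N)] ([superlevel_decay]).
    - With [b_k = t_k^p a_k] this reads [b_(k+1) <= D b_k^(2/N) e_k]: the
      exponent [p] is the one for which the powers of [t_k] cancel.
    - The slices share out the gradient of [f], so the [e_k] add up to at most
      the energy of [f] ([sum_sqr_slice_le]).  Summing over [k], the total [S]
      of the [b_k], which controls the sum of [f^p], satisfies
      [S <= b_0 + D B S^(2/N)]; as [2/N < 1] this bounds [S].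

    All these sums are taken over arbitrary finite sets of vertices; the
    infinite sums in the norms are the suprema of such finite sums. *)

Set Implicit Arguments.
Unset Strict Implicit.
Unset Printing Implicit Defensive.

(** * Finite sums *)

Lemma ler_sum_fset_incl (R : realType) (I : choiceType) (A B : {fset I})
    (F : I -> R) :
  (A `<=` B)%fset -> (forall x, 0 <= F x) ->
  \sum_(x <- A) F x <= \sum_(x <- B) F x.
Proof.
move=> AB F0; rewrite (big_fsetID _ (mem A) B) /=.
rewrite (_ : [fset x in B | x \in A]%fset = A) ?lerDl ?sumr_ge0//.
by apply/fsetP => x; rewrite !inE andbC andb_idr// => /(fsubsetP AB).
Qed.

Lemma sumr_const_fset (R : realType) (I : choiceType) (A : {fset I}) (c : R) :
  \sum_(x <- A) c = #|` A|%:R * c.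
Proof. by rewrite big_const_seq count_predT iter_addr_0 mulr_natl. Qed.

(** Monotone properties of finite sets can be witnessed uniformly over a finite
    family of indices: take the union of the individual witnesses. *)
Lemma ex_common_fset (I : eqType) (J : choiceType) (s : seq I)
    (P : I -> {fset J} -> Prop) :
  (forall i Z Z', (Z `<=` Z')%fset -> P i Z -> P i Z') ->
  (forall i, i \in s -> exists Z, P i Z) ->
  exists Z, forall i, i \in s -> P i Z.
Proof.
move=> mono; elim: s => [|i s ih] Ps; first by exists fset0.
have [Z1 Z1P] := Ps i (mem_head _ _).
have [j js|Z2 Z2P] := ih; first by apply: Ps; rewrite inE js orbT.
exists (Z1 `|` Z2)%fset => j; rewrite inE => /predU1P[->|js].
  exact: mono (fsubsetUl _ _) Z1P.
exact: mono (fsubsetUr _ _) (Z2P _ js).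
Qed.

(** * Energy and translations *)

Section Energy.
Variables (R : realType) (G : groupType) (T : {fset G}).
Implicit Types (f : G -> R) (X Z : {fset G}).

(** The inner sum of the energy: the neighbours of [x] are the [x s], and they
    are pairwise distinct. *)
Definition sqgrad f x : R := \sum_(s <- T) (f (x * s)%g - f x) ^+ 2.

Lemma sqgrad_ge0 f x : 0 <= sqgrad f x.
Proof. by apply: sumr_ge0 => s _; exact: sqr_ge0. Qed.

(** Walk from [x] to [x h] letter by letter: each step costs at most the square
    root of the energy in [l^2] norm, and the triangle inequality adds up
    [size w] of them.  The set [Z] collects the vertices met on the way from
    the points of [X]; keeping it finite and explicit avoids any summability
    assumption on [f]. *)
Lemma translation_sqdiff_le f X (w : seq G) : {in w, forall s, s \in T} ->
  exists Z, \sum_(x <- X) (f (x * \prod_(s <- w) s)%g - f x) ^+ 2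
            <= (size w)%:R ^+ 2 * \sum_(z <- Z) sqgrad f z.
Proof.
elim: w X => [|s w ih] X wT.
  exists fset0; rewrite big_nil big1 ?expr0n ?mul0r// => x _.
  by rewrite mulg1 subrr expr0n.
have sT : s \in T by apply: wT; rewrite mem_head.
have [|Z' hZ'] := ih [fset x * s | x in X]%g%fset.
  by move=> y yw; apply: wT; rewrite inE yw orbT.
exists (Z' `|` X)%fset; move: hZ'; rewrite big_imfset/=; last first.
  by move=> x y _ _; exact: mulIg.
set E := \sum_(z <- (_ `|` _)%fset) _; set m : R := (size w)%:R => hZ'.
have m0 : 0 <= m by exact: ler0n.
have E0 : 0 <= E by apply: sumr_ge0 => z _; exact: sqgrad_ge0.
have hA : \sum_(x <- X) (f (x * s * \prod_(t <- w) t)%g - f (x * s)%g) ^+ 2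
    <= m ^+ 2 * E.
  apply: (le_trans hZ'); apply: ler_wpM2l; first exact: sqr_ge0.
  by apply: ler_sum_fset_incl; [exact: fsubsetUl|exact: sqgrad_ge0].
have hB : \sum_(x <- X) (f (x * s)%g - f x) ^+ 2 <= E.
  apply: (@le_trans _ _ (\sum_(x <- X) sqgrad f x)).
    apply: ler_sum => x _; rewrite /sqgrad (big_fsetD1 s)//= lerDl.
    by apply: sumr_ge0 => t _; exact: sqr_ge0.
  by apply: ler_sum_fset_incl; [exact: fsubsetUr|exact: sqgrad_ge0].
rewrite big_cons -[(size (s :: w))%:R]/((size w).+1%:R) -natr1 -/m.
(* The squared triangle inequality is used with weights adapted to the lengths
   m and 1: m (u + v)^2 <= (m + 1) (u^2 + m v^2), which is void for m = 0. *)
have [m_eq0|m_gt0] := eqVneq m 0.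
  have w0 : w = [::] by apply/size0nil/eqP; rewrite -(eqr_nat R) -/m m_eq0.
  rewrite m_eq0 add0r expr1n mul1r w0 big_nil mulg1.
  exact: hB.
have {}m_gt0 : 0 < m by rewrite lt_def m_gt0.
rewrite -(ler_pM2l m_gt0) mulr_sumr.
apply: (@le_trans _ _ (\sum_(x <- X) ((m + 1) *
    ((f (x * s * \prod_(t <- w) t)%g - f (x * s)%g) ^+ 2
    + m * (f (x * s)%g - f x) ^+ 2)))).
  apply: ler_sum => x _; rewrite mulgA.
  set a := f _; set b := f (x * s)%g; set c := f x.
  have := sqr_ge0 ((a - b) - m * (b - c)); nra.
rewrite -mulr_sumr big_split/= -mulr_sumr.
move: hA hB; set A := \sum_(x <- X) _ => hA; set B := \sum_(x <- X) _ => hB.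
have : m * B <= m * E by rewrite ler_pM2l.
nra.
Qed.

End Energy.

(** * Superlevel sets of a slice *)

Section LevelStep.
Variables (R : realType) (G : groupType) (T : {fset G}).
Implicit Types (f : G -> R) (X Z : {fset G}).

(** Double counting of the squared differences [(f (x h) - f x)^2], [x] in the
    plateau [A'] and [h] in the ball [F].  For fixed [x] the translations that
    keep [x h] inside [A] are at most [#|A|], hence at most half of [F]; the
    others contribute [t^2] each.  For fixed [h] the sum over [x] is bounded by the
    energy. *)
Lemma plateau_le f (t : R) (A A' F : {fset G}) (n : nat) :
  (forall x, x \notin A -> f x = 0) -> (forall x, x \in A' -> f x = t) ->
  (forall h, h \in F -> exists w : seq G,
     [/\ {in w, forall s, s \in T}, (size w <= n)%N & h = \prod_(s <- w) s]%g) ->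
  (0 < #|` F|)%N -> 2 * #|` A|%:R <= #|` F|%:R :> R ->
  exists Z, #|` A'|%:R * t ^+ 2 <= 2 * n%:R ^+ 2 * \sum_(z <- Z) sqgrad T f z.
Proof.
move=> fA fA' Fword F_gt0 AF.
have [h Z Z' ZZ'|h hF|Z hZ] := @ex_common_fset _ _ (enum_fset F) (fun h Z =>
    \sum_(x <- A') (f (x * h)%g - f x) ^+ 2
      <= n%:R ^+ 2 * \sum_(z <- Z) sqgrad T f z).
- move=> /le_trans; apply; apply: ler_wpM2l; first exact: sqr_ge0.
  by apply: ler_sum_fset_incl => //; exact: sqgrad_ge0.
- have [w [wT wn ->]] := Fword _ hF.
  have [Z hZ] := translation_sqdiff_le f A' wT.
  exists Z; apply: (le_trans hZ); apply: ler_wpM2r.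
    by apply: sumr_ge0 => z _; exact: sqgrad_ge0.
  by rewrite ler_pXn2r ?nnegrE ?ler0n// ler_nat.
exists Z; set E := \sum_(z <- Z) _ in hZ *.
have up : \sum_(h <- F) \sum_(x <- A') (f (x * h)%g - f x) ^+ 2
    <= #|` F|%:R * (n%:R ^+ 2 * E).
  rewrite -sumr_const_fset big_seq [leRHS]big_seq; apply: ler_sum => h.
  exact: hZ.
(* Lower bound for a fixed x: F2 is the part of the ball that leaves A. *)
have escape x : x \in A' ->
    #|` F|%:R / 2 * t ^+ 2 <= \sum_(h <- F) (f (x * h)%g - f x) ^+ 2.
  move=> xA'; rewrite (fA' _ xA').
  pose F1 := [fset h in F | (x * h)%g \in A]%fset.
  pose F2 := [fset h in F | (x * h)%g \notin A]%fset.
  have split (H : G -> R) :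
      \sum_(h <- F) H h = \sum_(h <- F1) H h + \sum_(h <- F2) H h.
    exact: (big_fsetID _ (fun h => (x * h)%g \in A)).
  have F1A : #|` F1|%:R <= #|` A|%:R :> R.
    have <- : #|` [fset (x * h)%g | h in F1]%fset| = #|` F1|.
      by rewrite card_in_imfset//= => g h _ _; exact: mulgI.
    rewrite ler_nat; apply: fsubset_leq_card.
    by apply/fsubsetP => y /imfsetP[h /=]; rewrite !inE => /andP[_ hA] ->.
  have FE : #|` F|%:R = #|` F1|%:R + #|` F2|%:R :> R.
    by rewrite -[LHS]mulr1 -sumr_const_fset split !sumr_const_fset !mulr1.
  rewrite split; apply: (@le_trans _ _ (#|` F2|%:R * t ^+ 2)).
    apply: ler_wpM2r; first exact: sqr_ge0.
    by move: AF F1A FE; lra.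
  rewrite -[leLHS]add0r; apply: lerD.
    by apply: sumr_ge0 => h _; exact: sqr_ge0.
  rewrite -sumr_const_fset big_seq [leRHS]big_seq; apply: ler_sum => h.
  by rewrite !inE => /andP[_ /fA ->]; rewrite sub0r sqrrN.
rewrite exchange_big/= in up.
have low : #|` A'|%:R * (#|` F|%:R / 2 * t ^+ 2) <=
    \sum_(x <- A') \sum_(h <- F) (f (x * h)%g - f x) ^+ 2.
  rewrite -sumr_const_fset big_seq [leRHS]big_seq; apply: ler_sum => x.
  exact: escape.
have F_gt0' : 0 < #|` F|%:R / 2 :> R by rewrite divr_gt0// ltr0n.
rewrite -(ler_pM2l F_gt0').
move: (le_trans low up); lra.
Qed.

(** The part of the value [r] that lies between the levels [t] and [2 t]. *)
Definition slice (t r : R) := Num.min (Num.max (r - t) 0) t.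

Lemma slice_low t r : 0 <= t -> r <= t -> slice t r = 0.
Proof. by move=> t0 rt; rewrite /slice max_r ?subr_le0// min_l. Qed.

Lemma slice_high t r : 0 <= t -> 2 * t <= r -> slice t r = t.
Proof. by move=> t0 rt; rewrite /slice max_l ?min_r; lra. Qed.

Lemma slice_diff_min t r : 0 <= t ->
  slice t r = Num.min r (2 * t) - Num.min r t.
Proof.
move=> t0; rewrite /slice.
by case: (leP (r - t) 0) => ?; case: (leP _ t) => ?; case: (leP r (2 * t)) => ?;
  case: (leP r t) => ?; lra.
Qed.

(** By [slice_diff_min] the slices at consecutive dyadic levels telescope, and
    they are all monotone; their increments are thus of one sign with sum at
    most [|a - b|], and a sum of squares is at most the square of the sum. *)
Lemma sum_sqr_slice_le (t : R) (K : nat) (a b : R) : 0 < t ->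
  \sum_(k < K) (slice (t * 2 ^+ k) a - slice (t * 2 ^+ k) b) ^+ 2
    <= (a - b) ^+ 2.
Proof.
move=> t0; wlog ba : a b / b <= a => [hw|].
  have [ba|/ltW ab] := leP b a; first exact: hw.
  rewrite -[leRHS]sqrrN opprB; under eq_bigr do rewrite -sqrrN opprB.
  exact: hw.
apply: (@le_trans _ _
  ((Num.min a (t * 2 ^+ K) - Num.min b (t * 2 ^+ K)) ^+ 2)); last first.
  by case: (leP a (t * 2 ^+ K)); case: (leP b (t * 2 ^+ K)); nra.
elim: K => [|K ih]; first by rewrite big_ord0 sqr_ge0.
rewrite big_ord_recr/=; apply: (le_trans (lerD ih (lexx _))).
have tK : 0 <= t * 2 ^+ K by rewrite mulr_ge0 ?exprn_ge0// ltW.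
have -> : t * 2 ^+ K.+1 = 2 * (t * 2 ^+ K) by rewrite exprS mulrCA.
move: (t * _) tK => r r0.
rewrite !slice_diff_min//.
set p := Num.min a r; set q := Num.min b r.
set p' := Num.min a (2 * r); set q' := Num.min b (2 * r).
have h1 : q <= p by rewrite /p /q; case: (leP a r); case: (leP b r); lra.
have h2 : q' - q <= p' - p.
  rewrite /p /q /p' /q'.
  by case: (leP a r); case: (leP b r); case: (leP a (2 * r));
    case: (leP b (2 * r)); lra.
nra.
Qed.

End LevelStep.

(** * The Sobolev inequality *)

Section Sobolev.
Variables (R : realType) (G : groupType) (T : {fset G}) (N C : R).
Hypotheses (N2 : 2 < N) (C0 : 0 < C).
Hypothesis balls : forall n, (1 <= n)%N -> exists F : {fset G},
  C * n%:R `^ N <= #|` F|%:R /\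
  forall h, h \in F -> exists w : seq G,
     [/\ {in w, forall s, s \in T}, (size w <= n)%N & h = \prod_(s <- w) s]%g.
Implicit Types (f : G -> R) (V X Z : {fset G}).

Definition superlevel f V t := [fset x in V | t < f x]%fset.

Definition decay_const := 2 * ((2 / C) `^ N^-1 + 1) ^+ 2.

(** [plateau_le] applied to a slice of [f].  If the superlevel set has [a]
    elements, the growth hypothesis gives a ball with at least [2 a] elements as
    soon as the radius reaches [(2 a / C)^(1/N)]. *)
Lemma superlevel_decay f V t : 0 < t -> (forall x, x \notin V -> f x <= t) ->
  exists Z, #|` superlevel f V (2 * t)|%:R * t ^+ 2 <=
    decay_const * #|` superlevel f V t|%:R `^ (2 / N)
      * \sum_(z <- Z) sqgrad T (slice t \o f) z.
Proof.
move=> t0 fV; set A := superlevel f V t; set A' := superlevel f V (2 * t).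
have sub : (A' `<=` A)%fset.
  by apply/fsubsetP => x; rewrite !inE => /andP[-> tf] /=; lra.
have [A0|A_gt0] := posnP #|` A|.
  exists fset0; rewrite big_nil mulr0.
  by move/fsubset_leq_card : sub; rewrite A0 leqn0 => /eqP ->; rewrite mul0r.
have N_gt2 := N2; have N0 : 0 < N by lra.
set a : R := #|` A|%:R.
have a1 : 1 <= a by rewrite ler1n.
pose r := (2 / C * a) `^ N^-1.
have r0 : 0 <= r by exact: powR_ge0.
have /andP[nr rn] := truncn_itv r0.
have [//|F [FC Fword]] := @balls (Num.truncn r).+1.
have aF : 2 * a <= #|` F|%:R.
  apply: le_trans FC; rewrite -ler_pdivrMl// mulrA [C^-1 * _]mulrC.
  have -> : 2 / C * a = r `^ N.
    by rewrite /r -powRrM mulVf ?gt_eqF// powRr1// mulr_ge0 ?divr_ge0 ?ler0n ?(ltW C0).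
  by apply: ge0_ler_powR; rewrite ?nnegrE ?ler0n//; lra.
have F_gt0 : (0 < #|` F|)%N by rewrite -(ltr0n R); apply: lt_le_trans aF; lra.
have [x|x|Z hZ] := plateau_le (f := slice t \o f) (t := t) (A := A) (A' := A')
    _ _ Fword F_gt0 aF.
- rewrite !inE negb_and -leNgt => /orP[/fV|] ft /=;
  by apply: slice_low => //; exact: ltW.
- by rewrite !inE => /andP[_ ft] /=; apply: slice_high; exact: ltW.
exists Z; apply: (le_trans hZ); apply: ler_wpM2r.
  by apply: sumr_ge0 => z _; exact: sqgrad_ge0.
rewrite /decay_const -mulrA ler_pM2l//.
have -> : a `^ (2 / N) = (a `^ N^-1) ^+ 2.
  by rewrite mulrC powRrM powR_mulrn ?powR_ge0.
rewrite -exprMn ler_pXn2r ?nnegrE ?ler0n ?mulr_ge0 ?addr_ge0 ?powR_ge0//.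
rewrite -natr1; apply: (@le_trans _ _ (r + 1)); first by rewrite lerD2r.
have C2 : 0 <= 2 / C by rewrite divr_ge0// ltW.
rewrite mulrDl mul1r -powRM//.
(* Rounding the radius up adds 1, which is absorbed because a >= 1. *)
rewrite lerD2l -[leLHS](powRr0 a); apply: ler_powR => //.
by rewrite invr_ge0; lra.
Qed.

Definition sobolev_exp : R := 2 * N / (N - 2).

(** The energy and the p-norm are homogeneous in [f], so that a bound for one
    positive value of [B] amounts to the Sobolev inequality.  The bound is the
    same for all supports: the support of [f] only enters the choice of the
    lowest level [t0], below which [f^p] adds up to at most 1. *)
Lemma lp_bound_of_energy_bound (B : R) : 0 <= B -> exists M : R, forall f V,
  (forall x, 0 <= f x) -> (forall x, x \notin V -> f x = 0) ->
  (forall Z, \sum_(z <- Z) sqgrad T f z <= B) ->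
  \sum_(x <- V) f x `^ sobolev_exp <= M.
Proof.
move=> B0; set p := sobolev_exp; have N_gt2 := N2.
have p0 : 0 < p by rewrite /p /sobolev_exp divr_gt0//; lra.
have Nn0 : N != 0 by rewrite gt_eqF//; lra.
have Nn2 : N - 2 != 0 by rewrite gt_eqF//; lra.
(* The relation between p and N that makes the powers of the level cancel. *)
have pq : p * (2 / N) = p - 2 by rewrite /p /sobolev_exp; field; exact/andP.
pose D := 2 `^ p * decay_const.
have D0 : 0 <= D by rewrite mulr_ge0 ?powR_ge0// mulr_ge0 ?sqr_ge0.
pose Smax := (1 + D * B) `^ (1 - 2 / N)^-1.
exists (1 + 2 `^ p * Smax) => f V f0 fV fB.
pose v : R := (#|` V|).+1%:R.
pose t0 := v `^ (- p^-1).
have v0 : 0 < v by rewrite ltr0n.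
have t0_gt0 : 0 < t0 by exact: powR_gt0.
have t0p : t0 `^ p = v^-1.
  by rewrite /t0 -powRrM mulNr mulVf ?gt_eqF// powR_inv1// ltW.
have t0V : t0 `^ p * #|` V|%:R <= 1.
  by rewrite t0p ler_pdivrMl// mulr1 ler_nat leqnSn.
pose t k := t0 * 2 ^+ k.
have t_gt0 k : 0 < t k by rewrite mulr_gt0// exprn_gt0.
have tS k : t k.+1 = 2 * t k by rewrite /t exprS mulrCA.
pose a k : R := #|` superlevel f V (t k)|%:R.
pose b k := t k `^ p * a k.
have b0 k : 0 <= b k by rewrite mulr_ge0 ?powR_ge0 ?ler0n.
have [K fK] : exists K, forall x, x \in V -> f x <= t K.
  pose m := (\sum_(x <- V) f x) / t0.
  exists (Num.bound m) => x xV.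
  have /ltW := upper_nthrootP (leqnn (Num.bound m)).
  rewrite /m ler_pdivrMr// mulrC; apply: le_trans.
  by rewrite (big_fsetD1 x)//= lerDl sumr_ge0.
have step k : exists Z, b k.+1 <=
    D * b k `^ (2 / N) * \sum_(z <- Z) sqgrad T (slice (t k) \o f) z.
  have [|x xV|Z hZ] := @superlevel_decay f V (t k); first by [].
    by rewrite fV// ltW.
  have -> : b k `^ (2 / N) = t k `^ (p - 2) * a k `^ (2 / N).
    by rewrite powRM ?powR_ge0 ?ler0n// -powRrM pq.
  have -> : b k.+1 = 2 `^ p * t k `^ (p - 2) * (a k.+1 * t k ^+ 2).
    rewrite /b {1}tS powRM//; last exact: ltW.
    have {1}-> : t k `^ p = t k `^ (p - 2) * t k ^+ 2.
      rewrite -powR_mulrn; last exact: ltW.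
      by rewrite -powRD ?subrK// gt_eqF// implybT.
    ring.
  exists Z; have -> x y : D * (t k `^ (p - 2) * x) * y =
      2 `^ p * t k `^ (p - 2) * (decay_const * x * y) by rewrite /D; ring.
  by rewrite /a tS ler_pM2l// mulr_gt0 ?powR_gt0.
(* A finite set Z that serves all the levels at once lets the energies of the
   slices be added. *)
have [k Z Z' ZZ'|k _|Z hZ] := @ex_common_fset _ _ (iota 0 K) (fun k Z =>
    b k.+1 <= D * b k `^ (2 / N) * \sum_(z <- Z) sqgrad T (slice (t k) \o f) z).
- move=> /le_trans; apply; apply: ler_wpM2l.
    by rewrite mulr_ge0 ?powR_ge0.
  by apply: ler_sum_fset_incl => //; exact: sqgrad_ge0.
- exact: step.
pose S := \sum_(k < K.+1) b k.
have S0 : 0 <= S by apply: sumr_ge0.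
have sumE : \sum_(k < K) \sum_(z <- Z) sqgrad T (slice (t k) \o f) z <= B.
  apply: le_trans (fB Z); rewrite exchange_big/=; apply: ler_sum => z _.
  rewrite /sqgrad exchange_big/=; apply: ler_sum => s _.
  exact: sum_sqr_slice_le.
have bS k : (k < K.+1)%N -> b k <= S.
  move=> kK; rewrite /S (bigD1 (Ordinal kK))//= lerDl.
  by apply: sumr_ge0.
have Sle : S <= 1 + D * B * S `^ (2 / N).
  rewrite {1}/S big_ord_recl; apply: lerD.
    rewrite /b /t expr0 mulr1; apply: le_trans t0V.
    apply: ler_wpM2l; first exact: powR_ge0.
    by rewrite ler_nat fsubset_leq_card//; apply/fsubsetP => x; rewrite !inE => /andP[].
  rewrite mulrAC; apply: (@le_trans _ _ (\sum_(k < K) D * S `^ (2 / N) *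
      \sum_(z <- Z) sqgrad T (slice (t k) \o f) z)).
    apply: ler_sum => k _; rewrite lift0.
    have /hZ/le_trans : (k : nat) \in iota 0 K by rewrite mem_iota add0n/=.
    apply; apply: ler_wpM2r; first by apply: sumr_ge0 => z _; exact: sqgrad_ge0.
    apply: ler_wpM2l => //; apply: ge0_ler_powR; rewrite ?nnegrE//.
      by rewrite divr_ge0//; lra.
    by apply: bS; rewrite ltnS ltnW.
  rewrite -mulr_sumr; apply: ler_wpM2l => //.
  by rewrite mulr_ge0 ?powR_ge0.
have q1 : 0 < 1 - 2 / N by rewrite subr_gt0 ltr_pdivrMr; lra.
(* If S > 1, then 1 <= S^(2/N), and dividing the previous inequality by
   S^(2/N) leaves a positive power of S on the left. *)
have SS : S <= Smax.
  have [S1|S1] := leP S 1.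
    have one_root : 1 `^ (1 - 2 / N)^-1 = 1 :> R by rewrite powR1.
    apply: (le_trans S1); rewrite -[leLHS]one_root.
    apply: ge0_ler_powR; rewrite ?nnegrE ?invr_ge0 ?ler01//; first exact: ltW.
      by rewrite addr_ge0// mulr_ge0.
    by rewrite lerDl mulr_ge0.
  have Sq : S `^ (1 - 2 / N) <= 1 + D * B.
    rewrite powRD; last by rewrite gt_eqF// implybT.
    rewrite powRr1// powRN ler_pdivrMr ?powR_gt0//; last lra.
    apply: (le_trans Sle); rewrite [leRHS]mulrDl mul1r.
    rewrite lerD2r -[leLHS](powRr0 S); apply: ler_powR; first exact: ltW.
    by rewrite divr_ge0//; lra.
  rewrite -[leLHS]powRr1// -(mulfV (x := 1 - 2 / N)) ?gt_eqF// powRrM.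
  apply: ge0_ler_powR; rewrite ?nnegrE ?powR_ge0 ?invr_ge0//; first exact: ltW.
  by rewrite addr_ge0// mulr_ge0.
(* A value r between t_i and t_(i+1) has r^p <= 2^p t_i^p, and t_i^p is one of
   the terms of the sum. *)
have pointwise (r : R) k : 0 <= r -> r <= t k -> r `^ p <=
    t0 `^ p + 2 `^ p * \sum_(i < k) (if t i < r then t i `^ p else 0).
  move=> r0; elim: k => [|k ih].
    rewrite /t expr0 mulr1 big_ord0 mulr0 addr0 => rt.
    by apply: ge0_ler_powR; rewrite ?nnegrE// ltW.
  have [rt _|rt] := leP r (t k).
    apply: (le_trans (ih rt)); rewrite lerD2l; apply: ler_wpM2l; first exact: powR_ge0.
    by rewrite big_ord_recr/= ltNge rt addr0.
  rewrite tS => rt'; rewrite big_ord_recr/= rt mulrDr addrA.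
  rewrite -[leLHS]add0r; apply: lerD.
    rewrite addr_ge0 ?mulr_ge0 ?powR_ge0// sumr_ge0// => i _.
    by case: ifP => // _; exact: powR_ge0.
  rewrite -powRM//; last exact: ltW.
  apply: ge0_ler_powR => //; first exact: ltW.
  by rewrite nnegrE mulr_ge0// ltW.
apply: (@le_trans _ _ (\sum_(x <- V) (t0 `^ p +
    2 `^ p * \sum_(i < K) (if t i < f x then t i `^ p else 0)))).
  rewrite big_seq [leRHS]big_seq; apply: ler_sum => x xV.
  by apply: pointwise => //; exact: fK.
rewrite big_split/= sumr_const_fset mulrC; apply: lerD => //.
rewrite -mulr_sumr; apply: ler_wpM2l; first exact: powR_ge0.
apply: le_trans SS; rewrite /S big_ord_recr/= -[leLHS]addr0; apply: lerD => //.
rewrite exchange_big/=; apply: ler_sum => k _.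
rewrite -big_mkcond/= big_fset_condE sumr_const_fset mulrC.
by rewrite /b /a.
Qed.

End Sobolev.

(** * Unconditional sums through finite partial sums *)

Section SumsOverSets.
Variables (R : realType) (I : choiceType).
Implicit Types (F : I -> R) (Z : {fset I}).

Lemma esum_leP F (e : R) :
  (\esum_(x in [set: I]) (F x)%:E <= e%:E)%E <->
  forall Z, \sum_(x <- Z) F x <= e.
Proof.
split=> [le_e Z|le_e].
  rewrite -lee_fin; apply: le_trans le_e; apply: esum_ge.
  exists [set` Z]; first by split.
  by rewrite -fsbig_seq// sumEFin.
apply: ge_ereal_sup => _ [X [finX _] <-].
by rewrite fsbig_finite// sumEFin lee_fin.
Qed.

Lemma esum_lt_pinftyP F : (forall x, 0 <= F x) ->
  (\esum_(x in [set: I]) (F x)%:E < +oo)%E <->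
  exists B : R, forall Z, \sum_(x <- Z) F x <= B.
Proof.
move=> F0; split=> [Foo|[B /esum_leP /le_lt_trans]]; last by apply; exact: ltry.
exists (fine (\esum_(x in [set: I]) (F x)%:E)); apply/esum_leP.
rewrite fineK// ge0_fin_numE// esum_ge0// => x _.
by rewrite lee_fin.
Qed.

(** A finite set whose partial sum is within [d] of the supremum leaves at most
    [d] for any disjoint finite set. *)
Lemma sum_tail_le F (B d : R) : (forall Z, \sum_(x <- Z) F x <= B) -> 0 < d ->
  exists Z0, forall Z, \sum_(x <- Z | x \notin Z0) F x <= d.
Proof.
move=> FB d0; pose E := [set \sum_(x <- Z) F x | Z in [set: {fset I}]].
have supE : has_sup E.
  split; first by exists (\sum_(x <- fset0) F x), fset0.
  by exists B => _ [Z _ <-].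
have [_ [Z0 _ <-] lt_sup] := sup_adherent d0 supE.
exists Z0 => Z.
have : \sum_(x <- (Z0 `|` [fset x in Z | x \notin Z0])%fset) F x <= sup E.
  by apply: ub_le_sup; [case: supE|exists (Z0 `|` [fset x in Z | x \notin Z0])%fset].
rewrite (big_fsetID _ (mem Z0))/=.
rewrite (_ : [fset x in _ | x \in Z0]%fset = Z0); last first.
  by apply/fsetP => x; rewrite !inE; case: (x \in Z0); rewrite ?andbF.
rewrite (_ : [fset x in _ | x \notin Z0]%fset = [fset x in Z | x \notin Z0]%fset).
  by rewrite -big_fset_condE/=; move: lt_sup; lra.
by apply/fsetP => x; rewrite !inE; case: (x \in Z0); rewrite ?andbF ?andbT.
Qed.

Lemma near_forall_in_seq (s : seq I) (P : I -> nat -> Prop) :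
  (forall x, \forall n \near \oo, P x n) ->
  \forall n \near \oo, forall x, x \in s -> P x n.
Proof.
move=> nearP; elim: s => [|x s ih]; first by near=> n.
near=> n => y; rewrite inE => /predU1P[->|]; first by near: n; exact: nearP.
by move: y; near: n.
Unshelve. all: by end_near. Qed.

End SumsOverSets.

(** * The norms and the growth function *)

Section EnergyNorm.
Variables (R : realType) (G : groupType) (S : set G).
Hypothesis finS : finite_set S.
Let T := fset_set S.
Implicit Types (u : G -> R) (Z : {fset G}).

Lemma D12normE u :
  D12norm S u = sqrte (\esum_(x in [set: G]) (sqgrad T u x)%:E).
Proof.
congr sqrte; apply: eq_esum => x _.
rewrite (@reindex_esum _ _ _ S _ (fun s => (x * s)%g)); last first.
  split=> [s Ss|s s' _ _|y [s Ss ->]]; first by exists s.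
    exact: mulgI.
  by exists s.
rewrite esum_fset// fsbig_finite// sumEFin; congr (_%:E).
by apply: eq_bigr => s _; rewrite real_normK ?num_real.
Qed.

Lemma D12norm_leP u (e : R) : 0 <= e ->
  (D12norm S u <= e%:E)%E <-> forall Z, \sum_(z <- Z) sqgrad T u z <= e ^+ 2.
Proof.
move=> e0; rewrite D12normE.
have -> : e%:E = sqrte ((e ^+ 2)%:E) by rewrite /= sqrtr_sqr ger0_norm.
rewrite lee_sqrt ?lee_fin ?sqr_ge0//; exact: esum_leP.
Qed.

Lemma D12norm_lt_pinftyP u : (D12norm S u < +oo)%E <->
  exists B : R, forall Z, \sum_(z <- Z) sqgrad T u z <= B.
Proof.
rewrite -esum_lt_pinftyP; last exact: sqgrad_ge0.
by rewrite D12normE /sqrte; case: (\esum_(x in _) _) => [r| |]//; rewrite !ltry.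
Qed.

End EnergyNorm.

Lemma ellP (R : realType) (G : groupType) (p : R) (u : G -> R) :
  ell p u <-> exists M : R, forall Z : {fset G}, \sum_(x <- Z) `|u x| `^ p <= M.
Proof.
rewrite -esum_lt_pinftyP; last by move=> x; exact: powR_ge0.
rewrite /ell /= /summable; under eq_esum.
  by move=> x _; rewrite abse_EFin ger0_norm ?powR_ge0//; over.
by [].
Qed.

Section Balls.
Variables (R : realType) (G : groupType) (S : set G).
Hypothesis finS : finite_set S.

(** Word lengths are integers, so an infimum of lengths that is at most [n],
    hence less than [n + 1], is witnessed by a word of length at most [n]. *)
Lemma mem_word_ball n (h : G) : word_ball R S n h -> exists w : seq G,
  [/\ {in w, forall s, s \in fset_set S}, (size w <= n)%N
    & h = \prod_(s <- w) s]%g.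
Proof.
rewrite /word_ball /= /word_dist => hn.
have : (ereal_inf [set (size w)%:R%:E | w in
    [set w : seq G | {in w, forall s, S s} /\ h = (1 * \prod_(s <- w) s)%g]]
    < n.+1%:R%:E :> \bar R)%E.
  by apply: le_lt_trans hn _; rewrite lte_fin ltr_nat.
move=> /ereal_inf_lt[_ [w [wS hw] <-]]; rewrite lte_fin ltr_nat ltnS => wn.
exists w; split=> //; last by rewrite hw mul1g.
by move=> s /wS Ss; rewrite in_fset_set// mem_set.
Qed.

(** The elements of [fset_set (word_ball R S n)] are in the ball whether or not
    the ball is finite, as [fset_set] is empty on infinite sets. *)
Lemma growth_balls (N C : R) : 0 < C ->
  (forall n, (1 <= n)%N -> C * n%:R `^ N <= (growth R S n)%:R) ->
  forall n, (1 <= n)%N -> exists F : {fset G}, C * n%:R `^ N <= #|` F|%:R /\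
    forall h, h \in F -> exists w : seq G,
      [/\ {in w, forall s, s \in fset_set S}, (size w <= n)%N
        & h = \prod_(s <- w) s]%g.
Proof.
move=> C0 growthS n n1; exists (fset_set (word_ball R S n)).
split; first exact: growthS.
move=> h hF; apply: mem_word_ball; move: hF; rewrite /fset_set.
case: pselect => // fin_ball; rewrite -/(fset_set _).
by case: cid => /= X ->.
Qed.

End Balls.

(** * Comparing energies *)

Section Comparison.
Variables (R : realType) (G : groupType) (T : {fset G}).
Implicit Types (f g h : G -> R) (Z V : {fset G}).

Lemma sqgrad_le_add f g h x :
  (forall y z, `|f y - f z| <= `|g y - g z| + `|h y - h z|) ->
  sqgrad T f x <= 2 * (sqgrad T g x + sqgrad T h x).
Proof.
move=> fgh; rewrite /sqgrad -big_split/= mulr_sumr; apply: ler_sum => s _.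
have := fgh (x * s)%g x.
rewrite -[(f _ - _) ^+ 2]real_normK ?num_real//.
rewrite -[(g _ - _) ^+ 2]real_normK ?num_real//.
rewrite -[(h _ - _) ^+ 2]real_normK ?num_real//.
move: (normr_ge0 (f (x * s)%g - f x)); move: `|_| => a a0.
move: `|_| => b; move: `|_| => c abc.
have := sqr_ge0 (b - c); nra.
Qed.

Lemma sqgrad_le_lipschitz f g x :
  (forall y z, `|f y - f z| <= `|g y - g z|) -> sqgrad T f x <= sqgrad T g x.
Proof.
move=> fg; apply: ler_sum => s _.
by rewrite -real_normK ?num_real// -[leRHS]real_normK ?num_real// lerXn2r
  ?nnegrE.
Qed.

(** The gradient vanishes off the support and its neighbours, so the energy is a
    finite sum. *)
Lemma finite_support_energy f V : (forall x, x \notin V -> f x = 0) ->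
  exists B : R, forall Z, \sum_(z <- Z) sqgrad T f z <= B.
Proof.
move=> fV; pose W := (V `|` [fset x * s^-1 | x in V, s in T]%g)%fset.
exists (\sum_(z <- W) sqgrad T f z) => Z.
rewrite [leRHS](@big_fset_incl _ _ _ _ W (Z `|` W)%fset) ?fsubsetUr//.
  by apply: ler_sum_fset_incl; [exact: fsubsetUl|exact: sqgrad_ge0].
move=> x _; rewrite !inE negb_or => /andP[xV xW].
rewrite /sqgrad big_seq big1// => s sT; rewrite !fV ?subrr ?expr0n//.
apply: contra xW => xsV; apply/imfset2P; exists (x * s)%g => //.
by exists s => //; rewrite mulgK.
Qed.

End Comparison.

(** * Truncation at small values *)

Section Clip.
Variable R : realType.
Implicit Types e r s : R.

Definition clip e r := Num.max (- e) (Num.min e r).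

Lemma clip_norm_le e r : 0 <= e -> `|clip e r| <= e.
Proof.
move=> e0; rewrite ler_norml /clip.
by case: (leP e r) => ?; [case: (leP (- e) e)|case: (leP (- e) r)] => ?;
  apply/andP; split; lra.
Qed.

Lemma clip_id e r : `|r| <= e -> clip e r = r.
Proof. by rewrite ler_norml => /andP[er re]; rewrite /clip min_r// max_r. Qed.

Lemma clip_lipschitz e r s : 0 <= e -> `|clip e r - clip e s| <= `|r - s|.
Proof.
move=> e0; wlog sr : r s / s <= r => [hw|].
  have [/hw//|/ltW/hw] := leP s r.
  by rewrite distrC [X in _ <= X]distrC.
have /andP[le0 le_rs] : 0 <= clip e r - clip e s <= r - s.
  rewrite /clip; case: (leP e r); case: (leP e s); case: (leP (- e) e);
    case: (leP (- e) r); case: (leP (- e) s); lra.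
by rewrite !ger0_norm// subr_ge0.
Qed.

End Clip.

(** * The two inclusions *)

Section Inclusions.
Variables (R : realType) (G : groupType) (S : set G).
Hypothesis finS : finite_set S.
Let T := fset_set S.
Implicit Types (u : G -> R) (Z : {fset G}).

(** Dominated convergence: outside a finite set [Z0] the energy of the clip is at
    most that of [u], which is small there, and on [Z0] each increment of the
    clip is at most twice the clipping height. *)
Lemma clip_energy_cvg0 u (B d : R) :
  (forall Z, \sum_(z <- Z) sqgrad T u z <= B) -> 0 < d ->
  exists n0 : nat, forall n, (n0 <= n)%N -> forall Z,
    \sum_(z <- Z) sqgrad T (clip n.+1%:R^-1 \o u) z <= d.
Proof.
move=> uB d0; have d2 : 0 < d / 2 by lra.
have [Z0 tail] := sum_tail_le uB d2.
pose c : R := #|` Z0|%:R * (#|` T|%:R * 4).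
have c0 : 0 <= c by rewrite !mulr_ge0.
exists (Num.bound (c / (d / 2))) => n n0n Z.
set e : R := n.+1%:R^-1.
have e0 : 0 < e by rewrite invr_gt0 ltr0n.
have e1 : e <= 1 by rewrite invf_le1 ?ler1n ?ltr0n.
have ce : c * e <= d / 2.
  rewrite ler_pdivrMr ?ltr0n// mulrC -ler_pdivrMr//.
  apply: le_trans (ltW (archi_boundP _)) _; first by rewrite divr_ge0// ltW.
  by rewrite ler_nat leqW.
rewrite (bigID (mem Z0))/= (splitr d); apply: lerD; last first.
  apply: le_trans (tail Z); apply: ler_sum => z _.
  by apply: sqgrad_le_lipschitz => x y; apply: clip_lipschitz; exact: ltW.
apply: le_trans ce.
have small z : sqgrad T (clip e \o u) z <= #|` T|%:R * 4 * e.
  rewrite -mulrA -sumr_const_fset; apply: ler_sum => s _ /=.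
  have := clip_norm_le (u (z * s)%g) (ltW e0).
  have := clip_norm_le (u z) (ltW e0).
  rewrite !ler_norml; move: (clip _ _) (clip _ _) => a b.
  by move=> /andP[? ?] /andP[? ?]; nra.
rewrite big_fset_condE /c -mulrA -sumr_const_fset.
apply: (@le_trans _ _ (\sum_(z <- Z0) sqgrad T (clip e \o u) z)).
  apply: ler_sum_fset_incl; last exact: sqgrad_ge0.
  by apply/fsubsetP => z; rewrite !inE => /andP[].
by apply: ler_sum => z _; exact: small.
Qed.

(** The difference of two truncations of [u] is a difference of two clips, whose
    energies are small. *)
Lemma D12_sub_D12_0 (N : R) : 2 < N -> D12 N S `<=` @D12_0 R G S.
Proof.
move=> N2 u [/ellP[M uM] /(D12norm_lt_pinftyP finS)[B uB]].
set p := 2 * N / (N - 2) in uM.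
have e0 n : 0 < n.+1%:R^-1 :> R by rewrite invr_gt0 ltr0n.
exists (fun n x => u x - clip n.+1%:R^-1 (u x)); split.
- move=> n; rewrite /finitely_supported; set e : R := n.+1%:R^-1.
  have ep : 0 < e `^ p by rewrite powR_gt0// e0.
  apply: contrapT => /(infinite_set_fset (Num.bound (M / e `^ p)))[Z Zu Zcard].
  have M0 : 0 <= M by have := uM fset0; rewrite big_nil.
  have : #|` Z|%:R * e `^ p <= M.
    apply: le_trans (uM Z); rewrite -sumr_const_fset big_seq [leRHS]big_seq.
    apply: ler_sum => x /Zu /= ux; apply: ge0_ler_powR; rewrite ?nnegrE//.
    + by rewrite divr_ge0//; lra.
    + exact: ltW (e0 n).
    + by rewrite leNgt; apply: contra ux => /ltW/clip_id ->; rewrite subrr.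
  rewrite -ler_pdivlMr// leNgt => /negP; apply.
  apply: (lt_le_trans (archi_boundP _)); first by rewrite divr_ge0// ltW.
  by rewrite ler_nat.
- move=> e e_gt0.
  (* The energy of a difference is at most twice the sum of the energies, so
     1/16 makes the norm at most e / 2 < e. *)
  have d0 : 0 < e ^+ 2 / 16 by rewrite divr_gt0// exprn_gt0.
  have [n0 small] := clip_energy_cvg0 uB d0.
  exists n0 => m n n0m n0n; apply: (@le_lt_trans _ _ (e / 2)%:E); last first.
    by rewrite lte_fin; lra.
  apply/(D12norm_leP finS); first lra.
  move=> Z; apply: (@le_trans _ _ (\sum_(z <- Z)
      2 * (sqgrad T (clip n.+1%:R^-1 \o u) z + sqgrad T (clip m.+1%:R^-1 \o u) z))).
    apply: ler_sum => z _; apply: sqgrad_le_add => x y /=.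
    apply: le_trans (ler_normB _ _); rewrite le_eqVlt; apply/orP; left.
    by apply/eqP; congr `|_|; ring.
  rewrite -mulr_sumr big_split/=.
  have := small m n0m Z; have := small n n0n Z; lra.
- move=> x; rewrite -[X in _ --> X]subr0; apply: cvgB; first exact: cvg_cst.
  apply: (@squeeze_cvgr _ _ _ _ (fun n => - harmonic n) harmonic).
  + by near=> n; rewrite -ler_norml; apply: clip_norm_le; exact: ltW.
  + by rewrite -oppr0; apply: cvgN; exact: cvg_harmonic.
  + exact: cvg_harmonic.
Unshelve. all: by end_near. Qed.

Lemma sqgrad_cvg u (v : nat -> G -> R) Z :
  (forall x, v n x @[n --> \oo] --> u x) ->
  \sum_(z <- Z) sqgrad T (v n) z @[n --> \oo] --> \sum_(z <- Z) sqgrad T u z.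
Proof.
move=> vu; apply: cvg_big => [|z _]; first exact: add_continuous.
apply: cvg_big => [|s _]; first exact: add_continuous.
by under eq_fun do rewrite expr2; rewrite expr2; apply: cvgM; exact: cvgB.
Qed.

(** The energies of a Cauchy sequence are bounded, hence so are its p-norms; both
    bounds survive in the pointwise limit on each finite set. *)
Lemma D12_0_sub_D12 (N C : R) : 2 < N -> 0 < C ->
  (forall n, (1 <= n)%N -> C * n%:R `^ N <= (growth R S n)%:R) ->
  @D12_0 R G S `<=` D12 N S.
Proof.
move=> N2 C0 growthS u [v [vfin vcauchy vu]].
pose V n := fset_set [set x | v n x != 0].
have vV n x : x \notin V n -> v n x = 0.
  rewrite in_fset_set//; last exact: vfin.
  by move=> xV; apply/eqP/negPn/negP => vx; move/negP: xV; apply; exact: mem_set.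
have [n0 hn0] := vcauchy 1 ltr01.
have [B0 hB0] := finite_support_energy T (vV n0).
pose B := 2 * (1 + B0).
have vB n : (n0 <= n)%N -> forall Z, \sum_(z <- Z) sqgrad T (v n) z <= B.
  move=> n0n Z; apply: (@le_trans _ _ (\sum_(z <- Z)
      2 * (sqgrad T (v n \- v n0) z + sqgrad T (v n0) z))).
    apply: ler_sum => z _; apply: sqgrad_le_add => x y /=.
    apply: le_trans (ler_normD _ _); rewrite le_eqVlt; apply/orP; left.
    by apply/eqP; congr `|_|; ring.
  rewrite -mulr_sumr big_split/= ler_pM2l//; apply: lerD => //.
  have /ltW := hn0 n n0 n0n (leqnn _).
  by move=> /(D12norm_leP finS _ ler01)/(_ Z); rewrite expr1n.
have B_ge0 : 0 <= B by have := vB n0 (leqnn _) fset0; rewrite big_nil.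
split; last first.
  apply/(D12norm_lt_pinftyP finS); exists B => Z.
  apply: (ler_cvg_to (sqgrad_cvg vu) (cvg_cst B)).
  near=> n; apply: vB; near: n; exact: nbhs_infty_ge.
have [M hM] := lp_bound_of_energy_bound N2 C0 (growth_balls finS C0 growthS) B_ge0.
apply/ellP; set p := 2 * N / (N - 2).
have p0 : 0 < p by rewrite divr_gt0//; lra.
exists (2 `^ p * M) => Z.
(* At a point where u does not vanish, |u| <= 2 |v n| eventually; this
   replaces the continuity of the power function at the cost of a factor
   2^p. *)
have half : \forall n \near \oo, forall x, x \in Z -> `|u x| <= 2 * `|v n x|.
  apply: near_forall_in_seq => x.
  have [->|ux] := eqVneq (u x) 0.
    by near=> n; rewrite normr0 mulr_ge0.
  have u2 : 0 < `|u x| / 2 by rewrite divr_gt0// normr_gt0.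
  have close : \forall n \near \oo, `|u x - v n x| < `|u x| / 2.
    exact: (cvgr_dist_lt _ _ (vu x)).
  near=> n; have : `|u x - v n x| < `|u x| / 2 by near: n.
  have := ler_normD (u x - v n x) (v n x); rewrite subrK; lra.
have [n [n0n hn]] : exists n, (n0 <= n)%N /\
    forall x, x \in Z -> `|u x| <= 2 * `|v n x|.
  near \oo => n; exists n; split; first by near: n; exact: nbhs_infty_ge.
  by near: n.
apply: (@le_trans _ _ (\sum_(x <- Z) 2 `^ p * `|v n x| `^ p)).
  rewrite big_seq [leRHS]big_seq; apply: ler_sum => x xZ.
  rewrite -powRM//; apply: ge0_ler_powR; first exact: ltW.
  - by rewrite nnegrE.
  - by rewrite nnegrE mulr_ge0.
  - exact: hn.
rewrite -mulr_sumr; apply: ler_wpM2l; first exact: powR_ge0.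
apply: (@le_trans _ _ (\sum_(x <- V n) `|v n x| `^ p)).
  rewrite [leRHS](@big_fset_incl _ _ _ _ _ (Z `|` V n)%fset) ?fsubsetUr//.
    by apply: ler_sum_fset_incl; [exact: fsubsetUl|move=> x; exact: powR_ge0].
  by move=> x _ /vV ->; rewrite normr0 powR0// gt_eqF.
apply: (hM (fun x => `|v n x|)) => [x|x /vV ->|Z']; rewrite ?normr0//.
apply: le_trans (vB n n0n Z'); apply: ler_sum => z _.
by apply: sqgrad_le_lipschitz => x y; exact: ler_dist_dist.
Unshelve. all: by end_near. Qed.

End Inclusions.

Unset Implicit Arguments.

Theorem corollary19 (R : realType) (N : R) (hN : 3 <= N)
  (G : groupType) (S : set G) (finS : finite_set S)
  (symS : S = [set (s^-1)%g | s in S]) (genS : generated S = [set: G])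
  (growthS : exists2 C : R, 0 < C &
     forall n : nat, (1 <= n)%N -> C * n%:R `^ N <= (growth R S n)%:R) :
  D12_0 S = D12 N S :> set (G -> R).
Proof.
have N2 : 2 < N by lra.
have [C C0 growthC] := growthS.
apply/seteqP; split; first exact: D12_0_sub_D12 C0 growthC.
exact: D12_sub_D12_0.
Qed.
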